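(* Consider the Polyhedral Clinching Auction run on the modified market as described in the context, with all participants reporting truthfully. At the moment just before the clinching step of any iteration, let $x_i=w(E_i)$ for the current $w$, let $d$ be the current demands, and let $X=\{i\in N: d_i>0\}$. Then for every $S\subseteq X$, $g_{x,d}(S)\ge x^*(S)-x(S)$.
   Context: Market model. Buyers $N_0=\{1,\dots,n\}$, sellers $M=\{1,\dots,m\}$, bipartite edge set $E_0\subseteq N_0\times M$; edge $(i,j)$ written $ij$; for a set $S$ of participants $E_S$ is the set of edges incident to a member of $S$ ($E_i=E_{\{i\}}$); $w(F)=\sum_{e\in F}w_e$. Each seller $j$ has a monotone submodular $f_j:2^{E_j}\to\mathbb R_+$, $f_j(\emptyset)=0$ ($f_j(E_j)$ = her total amount of a homogeneous divisible good). Buyer $i$ has per-unit valuation $v_i>0$ and budget $B_i\ge0$; seller $j$ has per-unit valuation $\rho_j>0$. Modified market. For each seller $j$ add a virtual buyer $n+j$ adjacent only to $j$ with $v_{n+j}=\rho_j$, $B_{n+j}=\infty$; $V=\{n+1,\dots,n+m\}$, $N=\{1,\dots,n+m\}$, $E=E_0\cup\{(n+j)j\}$; extend $f_j$ by $f_j(F)=f_j(E_j)$ if $(n+j)j\in F$, unchanged otherwise; $P_j=\{y\in\mathbb R^{E_j}_+:y(F)\le f_j(F)\ \forall F\}$, $P=\{w\in\mathbb R^E_+:w|_{E_j}\in P_j\ \forall j\}$, $f(S)=\sum_jf_j(S\cap E_j)$. For $i\in N$, $H_i$ is the set of buyers $k$ with $v_k>v_i$, or $v_k=v_i$ and $k<i$;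 $x^*\in\mathbb R^N_+$ is defined recursively (decreasing valuation, ties by index) by $x^*_i=\min(B_i/v_i,\min_{H\subseteq H_i}\{f(E_{H\cup\{i\}})-x^*(H)\})$ (an optimal liquid-welfare allocation). For $x\in\mathbb R^N_+$, $d\in[0,\infty]^N$ and $S\subseteq N$: $g_{x,d}(S)=\min_{S'\subseteq S}\bigl\{\min_{S'\subseteq S''\subseteq N}\{f(E_{S''})-x(S'')\}+d(S\setminus S')\bigr\}$. Polyhedral Clinching Auction (PCA) with step $\varepsilon>0$: bids $v'_i$ for $i\in N$ (virtual buyer $n+j$ bids seller $j$'s bid), all assumed to be positive integer multiples of $\varepsilon$. State: $w\in\mathbb R^E_+$, payments $p\in\mathbb R^N_+$, revenues $r\in\mathbb R^M_+$, price clocks $c_i$, demands $d_i\in[0,\infty]$; initially $w=0,p=0,r=0$, $c_i=0$, $d_i=\infty$, pointer $l=1$. For $w,d$ let $P_{w,d}=\{y\in\mathbb R^E_+: w+y\in P,\ y(E_k)\le d_k\ \forall k\}$ and for $\xi\in\mathbb R^{E_i}_+$ let $P^i_{w,d}(\xi)=\{u\in\mathbb R^{N\setminus\{i\}}_+:\exists y\in P_{w,d},\ y|_{E_i}=\xi,\ y(E_k)=u_k\ \forall k\ne i\}$. While some $d_i\neq 0$, an iteration does: (1) clinching step: for $i=1,\dots,n+m$ in turn, choose a maximal $\xi_i\in\mathbb R^{E_i}_+$ with $P^i_{w,d}(\xi_i)=P^i_{w,d}(0)$, set $p_i\leftarrow p_i+c_i\xi_i(E_i)$, $w_{ij}\leftarrow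 w_{ij}+\xi_{ij}$, and reset every demand to $d_k=(B_k-p_k)/c_k$ if $c_k<v'_k$ and $d_k=0$ otherwise ($d_k=\infty$ while $c_k=0$); then $r_j\leftarrow r_j+\sum_{ij\in E_j}c_i\xi_{ij}$; (2) $c_l\leftarrow c_l+\varepsilon$ and $d_l\leftarrow(B_l-p_l)/c_l$ if $c_l<v'_l$, else $d_l\leftarrow0$; (3) advance $l$ cyclically. Truthful reporting means $v'_i=v_i$ for all $i\in N$. *)

(* Defs.v *)
From HB Require Import structures.
From mathcomp Require Import all_boot all_order all_algebra.
From mathcomp Require Import constructive_ereal.
Set Implicit Arguments. Unset Strict Implicit. Unset Printing Implicit Defensive.
Import Order.TTheory GRing.Theory Num.Theory.
Local Open Scope ring_scope.

Section PCA.
Variables (n m : nat) (R : realFieldType).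

(* Participants of the modified market: N = 'I_(n+m); the real buyer b : 'I_n
   is [lshift m b] (index b), the virtual buyer of seller j is [rshift n j]
   (index n + j).  Sellers are 'I_m.  Edges are pairs (buyer, seller). *)
Definition Nm := 'I_(n + m).
Definition edge := (Nm * 'I_m)%type.

Variable E0 : {set 'I_n * 'I_m}.
Variable f : 'I_m -> {set 'I_n * 'I_m} -> R.      (* f j, used on subsets of E0_j *)
Variables (v : 'I_n -> R) (B : 'I_n -> R) (rho : 'I_m -> R).

Definition E0j (j : 'I_m) : {set 'I_n * 'I_m} := [set e in E0 | e.2 == j].

Definition Emod : {set edge} :=
  [set (lshift m e.1, e.2) | e in E0] :|: [set (rshift n j, j) | j : 'I_m].

Definition Ej (j : 'I_m) : {set edge} := [set e in Emod | e.2 == j].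
Definition Ei (i : Nm) : {set edge} := [set e in Emod | e.1 == i].
Definition ES (S : {set Nm}) : {set edge} := [set e in Emod | e.1 \in S].

Definition fmod (j : 'I_m) (F : {set edge}) : R :=
  if (rshift n j, j) \in F then f j (E0j j)
  else f j [set e in E0j j | (lshift m e.1, e.2) \in F].

Definition ftot (S : {set edge}) : R := \sum_(j < m) fmod j (S :&: Ej j).

Definition vm (i : Nm) : R :=
  match split i with inl b => v b | inr j => rho j end.
Definition Bv (i : Nm) : \bar R :=
  match split i with inl b => (B b / v b)%:E | inr _ => +oo%E end.

Definition Hset (i : Nm) : {set Nm} :=
  [set k | (vm i < vm k) || ((vm k == vm i) && (k < i)%N)].

Definition sumN (x : Nm -> R) (S : {set Nm}) : R := \sum_(i in S) x i.

(* x^* : the (unique) solution of the recursive definition *)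
Definition is_xstar (xs : Nm -> R) : Prop :=
  forall i : Nm, (xs i)%:E =
    mine (Bv i) (\big[mine/+oo%E]_(H : {set Nm} | H \subset Hset i)
                    (ftot (ES (H :|: [set i])) - sumN xs H)%:E).

Definition gxd (x : Nm -> R) (d : Nm -> \bar R) (S : {set Nm}) : \bar R :=
  \big[mine/+oo%E]_(S' : {set Nm} | S' \subset S)
     ((\big[mine/+oo%E]_(S'' : {set Nm} | S' \subset S'')
          (ftot (ES S'') - sumN x S'')%:E)
      + \sum_(i in S :\: S') d i)%E.

Definition sumE (y : edge -> R) (A : {set edge}) : R := \sum_(e in A) y e.

(* w in P  (w is considered on the coordinates E only) *)
Definition inP (w : edge -> R) : Prop :=
  (forall e, e \in Emod -> 0 <= w e) /\
  (forall (j : 'I_m) (F : {set edge}), F \subset Ej j -> sumE w F <= fmod j F).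

Definition inPwd (w : edge -> R) (d : Nm -> \bar R) (y : edge -> R) : Prop :=
  (forall e, e \in Emod -> 0 <= y e) /\ inP (fun e => w e + y e) /\
  (forall k : Nm, ((sumE y (Ei k))%:E <= d k)%E).

(* u in P^i_{w,d}(xi);  u : R^{N \ {i}} is represented by a function on N
   whose value at i is ignored *)
Definition Pi (w : edge -> R) (d : Nm -> \bar R) (i : Nm) (xi : edge -> R)
    (u : Nm -> R) : Prop :=
  (forall k, k != i -> 0 <= u k) /\
  exists y, inPwd w d y /\ (forall e, e \in Ei i -> y e = xi e) /\
            (forall k, k != i -> sumE y (Ei k) = u k).

Definition clinchable w d i (xi : edge -> R) : Prop :=
  (forall e, e \in Ei i -> 0 <= xi e) /\
  (forall u, Pi w d i xi u <-> Pi w d i (fun _ => 0) u).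

Definition max_clinch w d i (xi : edge -> R) : Prop :=
  clinchable w d i xi /\
  forall xi', clinchable w d i xi' -> (forall e, e \in Ei i -> xi e <= xi' e) ->
    forall e, e \in Ei i -> xi' e = xi e.

Variable eps : R.

Record state := State {
  sw : edge -> R; sp : Nm -> R; sr : 'I_m -> R;
  sc : Nm -> R; sd : Nm -> \bar R; sl : nat }.

(* truthful bids v'_i = v_i (virtual buyer n+j bids rho_j) *)
Definition demand (k : Nm) (pk ck : R) : \bar R :=
  if ck == 0 then +oo%E
  else if ck < vm k then
    match split k with inl b => ((B b - pk) / ck)%:E | inr _ => +oo%E end
  else 0%E.

Definition init_state : state :=
  State (fun _ => 0) (fun _ => 0) (fun _ => 0) (fun _ => 0) (fun _ => +oo%E) 0.

(* clinching of buyer i inside the clinching step (revenue of the clinched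
   amount credited right away) *)
Definition clinch_one (i : Nm) (s s' : state) : Prop :=
  exists xi, max_clinch (sw s) (sd s) i xi /\
    let p' := fun k => if k == i then sp s k + sc s i * sumE xi (Ei i) else sp s k in
    s' = State (fun e => if e \in Ei i then sw s e + xi e else sw s e)
               p'
               (fun j => sr s j + \sum_(e in Ei i :&: Ej j) sc s i * xi e)
               (sc s)
               (fun k => demand k (p' k) (sc s k))
               (sl s).

Definition price_step (s : state) : state :=
  let c' := fun k : Nm => if nat_of_ord k == sl s then sc s k + eps else sc s k in
  State (sw s) (sp s) (sr s) c'
        (fun k => if nat_of_ord k == sl s then demand k (sp s k) (c' k) else sd s k)
        ((sl s).+1 %% (n + m)).

Definition iteration (s s' : state) : Prop :=
  exists sts : nat -> state, sts 0%N = s /\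
    (forall k : 'I_(n + m), clinch_one k (sts k) (sts k.+1)) /\
    s' = price_step (sts (n + m)%N).

(* states reached just before the clinching step of an iteration
   (together with the loop condition, see theorem) *)
Inductive reachable : state -> Prop :=
| reach_init : reachable init_state
| reach_step s s' : reachable s -> (exists i, sd s i != 0%E) ->
    iteration s s' -> reachable s'.

End PCA.

(* Main.v *)
(* Write X for the active buyers and E for the edges.  The invariant carried
   along the auction is x*(S) - x(S) + w(F) <= f(F) for all S within X and all
   edge sets F containing E_S.  It holds initially because x* is feasible.  When
   buyer i clinches xi, the inequality for S containing i is unchanged, since
   x(S) and w(F) both grow by xi(E_i).  For S avoiding i, the deficits
   u_k = max(0, x*_k - x_k) of the other active buyers are within their demands
   (payments are at most c_k x_k with c_k < v_k, and x*_k <= B_k / v_k), and by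
   the invariant they are realized by some edge allocation; so u lies in
   P^i(0) = P^i(xi), which says that u is still feasible after the clinch. *)
Require Import Defs.
From HB Require Import structures.
From mathcomp Require Import all_boot all_order all_algebra.
From mathcomp Require Import constructive_ereal.
From mathcomp Require Import lra.
Set Implicit Arguments. Unset Strict Implicit. Unset Printing Implicit Defensive.
Import Order.TTheory GRing.Theory Num.Theory.
Local Open Scope ring_scope.

(** * Vectors with prescribed class sums under a submodular bound *)

Lemma sum_setUI (R : realFieldType) (I : finType) (h : I -> R) (F G : {set I}) :
  \sum_(e in F :|: G) h e + \sum_(e in F :&: G) h e =
  \sum_(e in F) h e + \sum_(e in G) h e.
Proof.
rewrite !(big_mkcond (fun e => e \in _)) -!big_split /=.
by apply: eq_bigr => e _; rewrite !inE; case: (e \in F); case: (e \in G); rewrite ?addr0 ?add0r.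
Qed.

Section SubmodularTransversal.
Variables (R : realFieldType) (T A : finType) (pi : T -> A) (psi : {set T} -> R).

Hypothesis psi_submod :
  forall F G : {set T}, psi (F :|: G) + psi (F :&: G) <= psi F + psi G.

(* The edges of [D] carry their final value [y]; [r a] is what class [a] still
   has to receive on its edges outside [D].  Edges are decided one at a time:
   the lower and upper bounds on the value of the next edge are compatible by
   uncrossing the two sets they come from. *)
Lemma submodular_transversal_extend (D : {set T}) (y : T -> R) (r : A -> R) :
  (forall e, 0 <= y e) -> (forall a, 0 <= r a) -> psi set0 = 0 ->
  (forall (S : {set A}) (F : {set T}),
     (forall e, pi e \in S -> e \notin D -> e \in F) ->
     \sum_(e in F :&: D) y e + \sum_(a in S) r a <= psi F) ->
  exists y' : T -> R,
    [/\ forall e, 0 <= y' e, forall e, e \in D -> y' e = y e,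
        forall F : {set T}, \sum_(e in F) y' e <= psi F
      & forall a, \sum_(e | (pi e == a) && (e \notin D)) y' e = r a].
Proof.
move=> y0 r0 psi0.
have [k] := ubnP #|~: D|; elim: k => // k IH in D y r y0 r0 *.
rewrite ltnS => cardD H.
case: (set_0Vmem (~: D)) => [DT | [e0]].
  have inD e : e \in D by apply: contraFT (in_set0 e); rewrite -DT inE.
  (* With every edge decided, the hypothesis for all classes and the empty set bounds the total of
     [r] by [psi set0 = 0]. *)
  have rT : r =1 fun _ => 0.
    have := H setT set0; rewrite psi0 set0I big_set0 add0r => rle.
    have {}rle : \sum_(a in [set: A]) r a <= 0.
      by apply: rle => e _; rewrite inD.
    move=> a; apply/eqP; rewrite eq_le r0 andbT; apply: le_trans rle.
    by rewrite (bigD1 a) ?inE //= lerDl sumr_ge0.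
  exists y; split=> // [F|a].
    have := H set0 F; rewrite big_set0 addr0 (setIidPl _) //.
      by apply => e; rewrite inE.
    by apply/subsetP=> e.
  by rewrite rT big1 // => e; rewrite inD andbF.
rewrite inE => e0D; set a0 := pi e0.
(* Pairs in [lowP] have [a0] among their classes and may miss only [e0] among the undecided edges of
   these classes. Each forces the value of [e0] to be at least [low], and [t] is the least
   nonnegative value meeting all these bounds. *)
pose lowP (p : {set A} * {set T}) :=
  (a0 \in p.1) && [forall e, [&& pi e \in p.1, e \notin D & e != e0] ==> (e \in p.2)].
pose low (p : {set A} * {set T}) :=
  \sum_(e in p.2 :&: D) y e + \sum_(a in p.1) r a - psi p.2.
pose t := \big[Num.max/0]_(p | lowP p) low p.
have t_ge0 : 0 <= t by apply: bigmax_ge_id.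
have t_ler : t <= r a0.
  apply: bigmax_le => //= -[S F] /andP[/= a0S /forallP SF].
  have := H (S :\ a0) F; rewrite /low /= (big_setD1 _ a0S) /= => HSF.
  suff: \sum_(e in F :&: D) y e + \sum_(a in S :\ a0) r a <= psi F by lra.
  apply: HSF => e; rewrite !inE => /andP[ea0 eS] eD.
  apply: (implyP (SF e)); rewrite eS eD /=.
  by apply: contraNneq ea0 => ->.
(* Uncross with each pair of [lowP]: [F] supplies [e0] to the union, and [a0] is not in [S :&: S'],
   so the hypothesis holds for both resulting pairs. *)
have t_up (S : {set A}) (F : {set T}) : a0 \notin S -> e0 \in F ->
    (forall e, pi e \in S -> e \notin D -> e \in F) ->
    \sum_(e in F :&: D) y e + t + \sum_(a in S) r a <= psi F.
  move=> a0S e0F SF; rewrite addrAC -lerBrDl.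
  apply: bigmax_le => [|[S' F'] /andP[/= a0S' /forallP SF']].
    by rewrite subr_ge0 H.
  have HU : \sum_(e in (F :|: F') :&: D) y e + \sum_(a in S :|: S') r a <= psi (F :|: F').
    apply: H => e; rewrite !inE => /orP[eS|eS] eD; first by rewrite SF.
    have [->|ne] := eqVneq e e0; first by rewrite e0F.
    by rewrite (implyP (SF' e)) ?orbT // eS eD ne.
  have HI : \sum_(e in (F :&: F') :&: D) y e + \sum_(a in S :&: S') r a <= psi (F :&: F').
    apply: H => e; rewrite !inE => /andP[eS eS'] eD; rewrite SF //=.
    apply: (implyP (SF' e)); rewrite eS' eD /=.
    by apply: contraNneq a0S => ee0; rewrite /a0 -ee0.
  have := psi_submod F F'.
  have := sum_setUI y (F :&: D) (F' :&: D).
  rewrite -setIUl -setIIl => Ey.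
  have Er := sum_setUI r S S'.
  rewrite /low /=; lra.
pose y1 e := if e == e0 then t else y e.
pose r1 a := if a == a0 then r a - t else r a.
have y1D (F : {set T}) : \sum_(e in F :&: D) y1 e = \sum_(e in F :&: D) y e.
  apply: eq_bigr => e; rewrite inE /y1 => /andP[_ eD].
  by case: eqP eD e0D => [->|//] ->.
have HS (S : {set A}) (F : {set T}) :
    (forall e, pi e \in S -> e \notin e0 |: D -> e \in F) ->
    \sum_(e in F :&: (e0 |: D)) y1 e + \sum_(a in S) r1 a <= psi F.
  move=> SF.
  have yE : \sum_(e in F :&: (e0 |: D)) y1 e =
      \sum_(e in F :&: D) y e + (if e0 \in F then t else 0).
    case: ifP => e0F.
      have -> : F :&: (e0 |: D) = e0 |: (F :&: D).
        by apply/setP=> e; rewrite !inE; case: eqP => // ->; rewrite e0F.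
      by rewrite big_setU1 ?inE ?(negPf e0D) ?andbF //= y1D {1}/y1 eqxx addrC.
    rewrite addr0 -y1D; apply: eq_bigl => e; rewrite !inE.
    by case: eqP => // ->; rewrite e0F.
  have rE : \sum_(a in S) r1 a = \sum_(a in S) r a - (if a0 \in S then t else 0).
    case: ifP => a0S.
      rewrite !(big_setD1 _ a0S) /= {1}/r1 eqxx addrAC; congr (_ + _ - _).
      by apply: eq_bigr => a; rewrite /r1 !inE => /andP[/negPf->].
    rewrite subr0; apply: eq_bigr => a aS; rewrite /r1.
    by case: eqP aS => // ->; rewrite a0S.
  rewrite {}yE {}rE.
  have SF' e : e != e0 -> pi e \in S -> e \notin D -> e \in F.
    by move=> ne eS eD; apply: SF => //; rewrite !inE negb_or ne.
  (* The value [t] cancels if it enters both sums; if it enters one, [t_up] or the maximum defining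
     [t] applies. *)
  case: ifP => e0F; case: ifP => a0S.
  - have : \sum_(e in F :&: D) y e + \sum_(a in S) r a <= psi F.
      apply: H => e eS eD; have [->//|ne] := eqVneq e e0; exact: SF'.
    lra.
  - rewrite subr0; apply: t_up; rewrite ?a0S // => e eS eD.
    have [->//|ne] := eqVneq e e0; exact: SF'.
  - have : low (S, F) <= t.
      apply: le_bigmax_cond; rewrite /lowP /= a0S /=; apply/forallP=> e.
      by apply/implyP=> /and3P[eS eD ne]; exact: SF'.
    by rewrite /low /=; lra.
  - rewrite addr0 subr0; apply: H => e eS eD; apply: SF' => //.
    by apply: contraFneq a0S => ee0; rewrite /a0 -ee0.
have [|||//|y' [y'0 y'D y'F y'r]] := IH (e0 |: D) y1 r1.
- by rewrite /y1 => e; case: eqP.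
- by rewrite /r1 => a; case: eqP => // ->; rewrite subr_ge0.
- apply: leq_trans cardD; apply: proper_card; apply/properP; split.
    by apply/subsetP=> e; rewrite !inE negb_or => /andP[].
  by exists e0; rewrite !inE ?eqxx.
exists y'; split=> // [e eD|a].
  rewrite y'D ?inE ?eD ?orbT // /y1.
  by case: eqP eD e0D => // -> ->.
have [a_a0|na] := eqVneq a a0.
  rewrite a_a0 (bigD1 e0) ?eqxx //= y'D ?inE ?eqxx // /y1 eqxx.
  have Er := y'r a0; rewrite /r1 eqxx in Er.
  apply: (@addIr _ (- t)); rewrite -Er [t + _]addrC addrK; apply: eq_bigl => e.
  by rewrite !inE negb_or -andbA [(e != e0) && _]andbC.
have := y'r a; rewrite /r1 (negPf na) => <-; apply: eq_bigl => e.
rewrite !inE negb_or; case: eqP => //= pe; suff -> : e != e0 by [].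
by apply: contra_neq na => ee0; rewrite /a0 -ee0.
Qed.
End SubmodularTransversal.

(** * Submodularity and edge allocations in the modified market *)

Section Market.
Variables (n m : nat) (R : realFieldType).
Variables (E0 : {set 'I_n * 'I_m}) (f : 'I_m -> {set 'I_n * 'I_m} -> R).
Hypothesis f_set0 : forall j, f j set0 = 0.
Hypothesis f_mono : forall j (F G : {set 'I_n * 'I_m}),
  F \subset G -> G \subset E0j E0 j -> f j F <= f j G.
Hypothesis f_submod : forall j (F G : {set 'I_n * 'I_m}),
  F \subset E0j E0 j -> G \subset E0j E0 j ->
  f j (F :|: G) + f j (F :&: G) <= f j F + f j G.

Local Notation edge := (edge n m).
Local Notation Nm := (Nm n m).
Local Notation E := (Emod E0).
Local Notation phi := (ftot E0 f).

Let trace j (F : {set edge}) := [set e in E0j E0 j | (lshift m e.1, e.2) \in F].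

Let trace_sub j F : trace j F \subset E0j E0 j.
Proof. by apply/subsetP=> e; rewrite inE => /andP[]. Qed.

Lemma fmod_mono j (F G : {set edge}) : F \subset G -> fmod E0 f j F <= fmod E0 f j G.
Proof.
move=> FG; rewrite /fmod -!/(trace j _); case: ifP => [/(subsetP FG) -> //|_].
case: ifP => _; apply: f_mono => //.
by apply/subsetP=> e; rewrite !inE => /andP[-> /(subsetP FG)].
Qed.

(** A set containing the virtual edge has the same value as the union, and monotonicity compares the
    intersection with the other set. Without that edge, submodularity of [f] applies to the
    traces. *)
Lemma fmod_submod j (F G : {set edge}) :
  fmod E0 f j (F :|: G) + fmod E0 f j (F :&: G) <= fmod E0 f j F + fmod E0 f j G.
Proof.
have mF : fmod E0 f j (F :&: G) <= fmod E0 f j F by apply/fmod_mono/subsetIl.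
have mG : fmod E0 f j (F :&: G) <= fmod E0 f j G by apply/fmod_mono/subsetIr.
have [jF|jF] := boolP ((rshift n j, j) \in F).
  have -> : fmod E0 f j (F :|: G) = fmod E0 f j F by rewrite /fmod inE jF.
  by rewrite lerD2l.
have [jG|jG] := boolP ((rshift n j, j) \in G).
  have -> : fmod E0 f j (F :|: G) = fmod E0 f j G by rewrite /fmod inE jG orbT.
  by rewrite addrC lerD2r.
rewrite /fmod -!/(trace j _) !inE (negPf jF) (negPf jG) /=.
have -> : trace j (F :|: G) = trace j F :|: trace j G.
  by apply/setP=> e; rewrite !inE -andb_orr.
have -> : trace j (F :&: G) = trace j F :&: trace j G.
  by apply/setP=> e; rewrite !inE; case: (e \in E0); case: eqP => //= _; rewrite andbF.
exact: f_submod.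
Qed.

Lemma ftot_mono (F G : {set edge}) : F \subset G -> phi F <= phi G.
Proof. by move=> FG; apply: ler_sum => j _; apply/fmod_mono/setSI. Qed.

Lemma ftot_submod (F G : {set edge}) :
  phi (F :|: G) + phi (F :&: G) <= phi F + phi G.
Proof.
rewrite /ftot -!big_split /=; apply: ler_sum => j _.
by rewrite setIUl setIIl; exact: fmod_submod.
Qed.

Lemma fmod0 j : fmod E0 f j set0 = 0.
Proof.
rewrite /fmod inE -!/(trace j _) -(f_set0 j); congr f.
by apply/setP=> e; rewrite !inE andbF.
Qed.

Lemma ftot0 : phi set0 = 0.
Proof. by rewrite /ftot big1 // => j _; rewrite set0I fmod0. Qed.

(** Different sellers have disjoint edge sets, so their constraints add up to one for [phi];
    conversely, on one seller's edges [phi] reduces to her [fmod]. *)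
Lemma inP_ftot (w : edge -> R) :
  inP E0 f w <-> (forall e, e \in E -> 0 <= w e) /\
    (forall F : {set edge}, sumE w (F :&: E) <= phi F).
Proof.
split=> -[w0 wF]; (split; first by []); [move=> F|move=> j F FEj].
  rewrite /sumE (partition_big (fun e : edge => e.2) predT) //=.
  apply: ler_sum => j _; rewrite (eq_bigl (fun e => e \in F :&: Ej E0 j)).
    exact/wF/subsetIr.
  by move=> e; rewrite !inE andbA.
have := wF F; rewrite (setIidPl _).
  move/le_trans; apply; rewrite /ftot (bigD1 j) //= (setIidPl FEj) big1 ?addr0 //.
  move=> k kj; rewrite -(fmod0 k); congr fmod; apply/setP=> e; rewrite !inE.
  apply/negbTE/negP=> /and3P[/(subsetP FEj)]; rewrite !inE => /andP[_ /eqP->] _.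
  by rewrite eq_sym (negPf kj).
by apply: subset_trans FEj _; apply/subsetP=> e; rewrite inE => /andP[].
Qed.

Lemma sumE_ES (w : edge -> R) (S : {set Nm}) :
  sumE w (ES E0 S) = \sum_(k in S) sumE w (Ei E0 k).
Proof.
rewrite /sumE (partition_big (fun e : edge => e.1) (mem S)) /=.
  apply: eq_bigr => k kS; apply: eq_bigl => e; rewrite !inE.
  by case: eqP => [->|_]; rewrite ?kS ?andbT ?andbF.
by move=> e; rewrite inE => /andP[].
Qed.

Lemma ler_sumE (w : edge -> R) (F G : {set edge}) :
  F \subset G -> (forall e, e \in G -> 0 <= w e) -> sumE w F <= sumE w G.
Proof.
move=> FG w0; rewrite /sumE [X in _ <= X](big_setID F) /= (setIidPr FG) lerDl.
by apply: sumr_ge0 => e; rewrite inE => /andP[_ /w0].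
Qed.

(** The extension lemma is applied to edges grouped by buyer, under the residual bound [psi]. Pairs
    outside [E] count as already decided with value 0, so only true edges carry [z]. *)
Lemma residual_realization (w : edge -> R) (z : Nm -> R) :
  (forall k, 0 <= z k) ->
  (forall (S : {set Nm}) (F : {set edge}), ES E0 S \subset F ->
     sumN z S + sumE w (F :&: E) <= phi F) ->
  exists y : edge -> R, [/\ forall e, 0 <= y e,
    forall F : {set edge}, sumE (fun e => w e + y e) (F :&: E) <= phi F
    & forall k, sumE y (Ei E0 k) = z k].
Proof.
move=> z0 zF; pose psi F := phi F - sumE w (F :&: E).
have psi_submod F G : psi (F :|: G) + psi (F :&: G) <= psi F + psi G.
  have := ftot_submod F G; have := sum_setUI w (F :&: E) (G :&: E).
  rewrite -setIUl -setIIl /psi /sumE => H1 H2; lra.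
have [||||y [y0 _ yF yz]] := @submodular_transversal_extend R edge Nm
   (fun e => e.1) psi psi_submod (~: E) (fun _ => 0) z.
- by [].
- by [].
- by rewrite /psi ftot0 set0I /sumE big_set0 subr0.
- move=> S F SF; rewrite big1 // add0r /psi lerBrDr; apply: zF.
  by apply/subsetP=> e; rewrite inE => /andP[eE eS]; apply: SF; rewrite // in_setC negbK.
exists y; split=> // [F|k].
  rewrite /sumE big_split /= -lerBrDl; apply: le_trans (yF F).
  by apply: ler_sumE => //; exact: subsetIl.
by rewrite -yz; apply: eq_bigl => e; rewrite !inE negbK andbC.
Qed.

(** * Demands as functions of payment and price *)

Variables (v B : 'I_n -> R) (rho : 'I_m -> R).
Hypothesis v_gt0 : forall b, 0 < v b.
Hypothesis B_ge0 : forall b, 0 <= B b.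

Local Notation demand := (demand v B rho).
Local Notation Bv := (Bv v B).
Local Notation vm := (vm v rho).

Lemma demand_lshift b p c : demand (lshift m b) p c =
  if c == 0 then +oo%E else if c < v b then ((B b - p) / c)%:E else 0%E.
Proof. by rewrite /demand /vm (unsplitK (inl b)). Qed.

Lemma demand_rshift j p c : demand (rshift n j) p c =
  if c == 0 then +oo%E else if c < rho j then +oo%E else 0%E.
Proof. by rewrite /demand /vm (unsplitK (inr j)). Qed.

Lemma demand_ge0 k p c : 0 <= c ->
  (forall b, k = lshift m b -> p <= B b) -> (0 <= demand k p c)%E.
Proof.
move=> c0 pB; case: (split_ordP k) pB => b -> pB.
  rewrite demand_lshift; case: eqP => [_|_]; first exact: leey.
  by case: ltP => // _; rewrite lee_fin divr_ge0 // subr_ge0 pB.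
by rewrite demand_rshift; case: eqP => [_|_]; [|case: ltP => // _]; exact: leey.
Qed.

(** Ensures that no buyer re-enters the active set while clocks and payments rise. *)
Lemma demand_gt0_antimono k p p' c c' : 0 <= c -> c <= c' -> p <= p' ->
  (0 < demand k p' c')%E -> (0 < demand k p c)%E.
Proof.
move=> c0 cc' pp'; case: (split_ordP k) => b ->.
  rewrite !demand_lshift; case: (eqVneq c 0) => [_ _|nc]; first exact: ltry.
  have c_gt0 : 0 < c by rewrite lt_def nc.
  have c'_gt0 := lt_le_trans c_gt0 cc'.
  rewrite gt_eqF //; case: (ltP c' (v b)) => [c'v|_]; last by rewrite ltxx.
  rewrite (le_lt_trans cc' c'v) !lte_fin !pmulr_lgt0 ?invr_gt0 // !subr_gt0.
  exact: le_lt_trans.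
rewrite !demand_rshift; case: (eqVneq c 0) => [_ _|nc]; first exact: ltry.
have c_gt0 : 0 < c by rewrite lt_def nc.
rewrite gt_eqF ?(lt_le_trans c_gt0) //; case: (ltP c' (rho b)) => [c'v|_]; last by rewrite ltxx.
by rewrite (le_lt_trans cc' c'v).
Qed.

(** For a real buyer at price [c > 0], positive demand forces [c < v], so [c * z <= v * z <= B] when
    [z >= 0]; [B >= 0] covers negative [z]. Combining with [p <= c * x] gives the bound. *)
Lemma demand_ge_deficit k p c x z : 0 <= c -> p <= c * x -> (z%:E <= Bv k)%E ->
  (0 < demand k p c)%E -> ((z - x)%:E <= demand k p c)%E.
Proof.
move=> c0 pcx; case: (split_ordP k) => b ->; last first.
  rewrite demand_rshift; case: eqP => [*|_]; first exact: leey.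
  by case: (ltP c (rho b)) => [*|_]; [exact: leey | rewrite ltxx].
rewrite /Bv (unsplitK (inl b)) demand_lshift lee_fin.
case: (eqVneq c 0) => [*|nc]; first exact: leey.
have c_gt0 : 0 < c by rewrite lt_def nc.
case: (ltP c (v b)) => [cv zB _|_ _]; last by rewrite ltxx.
rewrite lee_fin ler_pdivlMr // mulrBl; move: pcx; rewrite mulrC => pcx.
suff : z * c <= B b by lra.
have [z0|z0] := leP 0 z; last by apply: le_trans (B_ge0 b); rewrite nmulr_rle0 // ltW.
by move: zB; rewrite ler_pdivlMr // => /(le_trans _); apply; rewrite ler_wpM2l // ltW.
Qed.

(** * Feasibility of the recursive allocation *)

Variables (xs : Nm -> R) (eps : R).
Hypothesis eps_gt0 : 0 < eps.
Hypothesis Hxs : is_xstar E0 f v B rho xs.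

Lemma xstar_le_Bv k : ((xs k)%:E <= Bv k)%E.
Proof. by rewrite Hxs ge_min lexx. Qed.

(** Take a buyer of least valuation in [S], and the largest index among ties: the one the recursion
    treats last. *)
Lemma exists_last_buyer (S : {set Nm}) : S != set0 ->
  exists2 i, i \in S & S :\ i \subset Hset v rho i.
Proof.
case/set0Pn=> k0 k0S.
case: (arg_minP vm k0S) => i0 i0S i0min.
pose tied := [pred i : Nm | (i \in S) && (vm i == vm i0)].
have tied0 : tied i0 by rewrite /= eqxx andbT.
case: (arg_maxnP (fun i : Nm => nat_of_ord i) tied0) => i /andP[iS /eqP vi] imax.
exists i => //; apply/subsetP=> k; rewrite !inE => /andP[ki kS].
have := i0min k kS; rewrite -vi le_eqVlt => /orP[/eqP vk|->//].
have := imax k; rewrite /= kS -vk vi eqxx /= => /(_ isT) leki.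
by rewrite ltn_neqAle [_ == _ :> nat](negPf ki) leki orbT.
Qed.

(** The recursion at the last buyer [i] of [S], with [H = S :\ i], already yields the inequality,
    without induction. *)
Lemma xstar_le_ftot (S : {set Nm}) : sumN xs S <= phi (ES E0 S).
Proof.
have [->|/exists_last_buyer[i iS iH]] := eqVneq S set0.
  rewrite /sumN big_set0 -ftot0; apply: ftot_mono; exact: sub0set.
have : ((xs i)%:E <= (phi (ES E0 (S :\ i :|: [set i])) - sumN xs (S :\ i))%:E)%E.
  rewrite Hxs; rewrite ge_min; apply/orP; right; exact: bigmin_le_cond iH.
rewrite setUC setD1K // lee_fin /sumN (big_setD1 _ iS) /=; lra.
Qed.

(** * The invariant and its preservation *)

Local Notation state := (state n m R).

Definition alloc (s : state) (k : Nm) : R := sumE (sw s) (Ei E0 k).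
Definition active (s : state) : {set Nm} := [set k | (0 < sd s k)%E].

Record auction_inv (s : state) : Prop := AuctionInv {
  inv_demand : forall k, sd s k = demand k (sp s k) (sc s k);
  inv_price : forall k, 0 <= sc s k;
  inv_payment : forall k, sp s k <= sc s k * alloc s k;
  inv_budget : forall b, sp s (lshift m b) <= B b;
  inv_feasible : inP E0 f (sw s);
  (* Quantifying over all edge sets [F], rather than only those of the form
     [ES E0 S''], gives the actual residual capacity of [w]; this is what makes
     the inequality realizable by an edge allocation in the clinching step. *)
  inv_xstar : forall (S : {set Nm}) (F : {set edge}),
    S \subset active s -> ES E0 S \subset F ->
    sumN xs S - sumN (alloc s) S + sumE (sw s) (F :&: E) <= phi F }.

Lemma inv_demand_ge0 s k : auction_inv s -> (0 <= sd s k)%E.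
Proof.
move=> I; rewrite inv_demand //; apply: demand_ge0 => [|b ->].
  exact: inv_price. exact: inv_budget.
Qed.

Lemma inv_deficit_le_demand s k : auction_inv s -> k \in active s ->
  ((xs k - alloc s k)%:E <= sd s k)%E.
Proof.
move=> I; rewrite inE inv_demand //; apply: demand_ge_deficit.
- exact: inv_price.
- exact: inv_payment.
- exact: xstar_le_Bv.
Qed.

Lemma inv_init : auction_inv (init_state n m R).
Proof.
have s0 (A : {set edge}) : sumE (fun _ => 0 : R) A = 0 by rewrite /sumE big1.
split=> //= [k|k||S F _ SF].
- by rewrite /demand eqxx.
- by rewrite mul0r.
- by apply/inP_ftot; split=> // F; rewrite s0 -ftot0; exact/ftot_mono/sub0set.
rewrite /sumN [X in _ - X]big1 ?subr0 ?s0 ?addr0 => [|k _]; last exact: s0.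
exact: le_trans (xstar_le_ftot S) (ftot_mono SF).
Qed.

(* Raising prices only shrinks the set of active buyers, the only ones constrained by [inv_xstar]. *)
Lemma inv_price_step s : auction_inv s -> auction_inv (price_step v B rho eps s).
Proof.
move=> I; set s' := price_step _ _ _ _ _.
have cc' k : sc s k <= sc s' k by rewrite /=; case: eqP => // _; rewrite lerDl ltW.
have d' k : sd s' k = demand k (sp s' k) (sc s' k).
  by rewrite /=; case: eqP => // _; exact: inv_demand.
split=> // [k|k|b||S F Sact].
- exact: le_trans (inv_price I k) (cc' k).
- apply: le_trans (inv_payment I k) _; apply: ler_wpM2r => //.
  by apply: sumr_ge0 => e; rewrite inE => /andP[eE _]; case: (inv_feasible I) => w0 _; exact: w0.
- exact: inv_budget I b.
- exact: inv_feasible I.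
apply: (inv_xstar I); apply: subset_trans Sact _; apply/subsetP=> k.
rewrite !inE d' (inv_demand I).
exact: demand_gt0_antimono (inv_price I k) (cc' k) (lexx _).
Qed.

Lemma sumN_Ei_disjoint (w : edge -> R) i (S : {set Nm}) (F : {set edge}) :
  i \notin S -> ES E0 S \subset F -> (forall e, e \in E -> 0 <= w e) ->
  sumN (fun k => sumE w (Ei E0 k)) S <= sumE w ((F :&: E) :\: Ei E0 i).
Proof.
move=> iS SF w0; rewrite /sumN -sumE_ES; apply: ler_sumE => [|e].
  apply/subsetP=> e eS; rewrite in_setD in_setI (subsetP SF) //=.
  move: eS; rewrite !inE => /andP[-> eS]; rewrite !andbT /=.
  by apply: contraNneq iS => <-.
by rewrite in_setD in_setI => /and3P[_ _ /w0].
Qed.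

Lemma inv_clinch_one i s s' :
  auction_inv s -> clinch_one E0 f v B rho i s s' -> auction_inv s'.
Proof.
move=> I [xi [[[xi0 xiP] _] Es']].
have [w0 wF] := (inP_ftot (sw s)).1 (inv_feasible I).
pose u k : R := if (k \in active s) && (k != i) then Num.max 0 (xs k - alloc s k) else 0.
have u0 k : 0 <= u k by rewrite /u; case: ifP; rewrite // le_max lexx.
have uF (S : {set Nm}) (F : {set edge}) : ES E0 S \subset F ->
    sumN u S + sumE (sw s) (F :&: E) <= phi F.
  move=> SF.
  (* Only active buyers with nonnegative deficit can contribute to [u], so the invariant for [S1]
     suffices. *)
  pose S1 := [set k in S | (k \in active s) && (0 <= xs k - alloc s k)].
  have S1F : ES E0 S1 \subset F.
    apply: subset_trans SF; apply/subsetP=> e; rewrite !inE.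
    by case/andP=> [-> /andP[->]].
  have S1a : S1 \subset active s by apply/subsetP=> k; rewrite inE => /and3P[].
  apply: le_trans (inv_xstar I S1a S1F); rewrite lerD2r /sumN -sumrB.
  rewrite [X in X <= _]big_mkcond [X in _ <= X]big_mkcond; apply: ler_sum => k _.
  rewrite [k \in S1]inE; case: (k \in S) => //=; rewrite /u.
  case: (k \in active s) => //=.
  by case: (leP 0 (xs k - alloc s k)) => xk; case: eqP.
have [y [y0 yF yu]] := residual_realization u0 uF.
(* Since [u i = 0] and [y] is nonnegative, [y] vanishes on the edges of [i], as membership in [Pi]
   at 0 requires. *)
have yi e : e \in Ei E0 i -> y e = 0.
  have /eqP := yu i; rewrite /u eqxx andbF /sumE psumr_eq0 // => /allP y_i ei.
  by have := y_i e; rewrite mem_index_enum ei => /(_ isT) /eqP.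
have yfeas : inPwd E0 f (sw s) (sd s) y.
  split=> //; split.
    by apply/inP_ftot; split=> // e eE; rewrite addr_ge0 ?w0.
  move=> k; rewrite yu /u; case: ifP => [/andP[ka _]|_]; last exact: inv_demand_ge0.
  by rewrite EFin_max ge_max inv_demand_ge0 // inv_deficit_le_demand.
have [_ [y' [[y'0 [y'P y'd]] [y'xi y'u]]]] : Pi E0 f (sw s) (sd s) i xi u.
  by apply/xiP; split=> // ; exists y.
have {}y'F := ((inP_ftot _).1 y'P).2.
(* The clinched amount inherits the demand bound from [y']; this is what keeps the payment within
   budget. *)
have xid : ((sumE xi (Ei E0 i))%:E <= sd s i)%E.
  apply: le_trans (y'd i); rewrite lee_fin le_eqVlt; apply/orP; left; apply/eqP.
  by apply: eq_bigr => e /y'xi.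
have xis0 : 0 <= sumE xi (Ei E0 i) by apply: sumr_ge0.
have c0 := inv_price I i.
have w'E e : sw s' e = sw s e + (if e \in Ei E0 i then xi e else 0).
  by rewrite Es' /=; case: ifP; rewrite ?addr0.
have alloc' k : alloc s' k = alloc s k + (if k == i then sumE xi (Ei E0 i) else 0).
  rewrite /alloc /sumE (eq_bigr _ (fun e _ => w'E e)) big_split /=; congr (_ + _).
  case: eqP => [->|/eqP ki]; first by apply: eq_bigr => e ->.
  rewrite big1 // => e; rewrite !inE => /andP[_ /eqP->].
  by rewrite (negPf ki) andbF.
have sp' k : sp s' k = sp s k + (if k == i then sc s i * sumE xi (Ei E0 i) else 0).
  by rewrite Es' /=; case: ifP; rewrite ?addr0.
have sc' : sc s' = sc s by rewrite Es'.
have sd' k : sd s' k = demand k (sp s' k) (sc s' k) by rewrite Es'.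
have act' : active s' \subset active s.
  apply/subsetP=> k; rewrite !inE sd' inv_demand // sc'.
  apply: demand_gt0_antimono => //; first exact: inv_price.
  by rewrite sp' lerDl; case: eqP => // _; rewrite mulr_ge0.
have w'F F : sumE (sw s') (F :&: E) =
    sumE (sw s) (F :&: E) + sumE xi (F :&: Ei E0 i).
  rewrite /sumE (eq_bigr _ (fun e _ => w'E e)) big_split /=; congr (_ + _).
  rewrite -big_mkcondr; apply: eq_bigl => e; rewrite !inE.
  by rewrite -andbA; congr (_ && _); rewrite andbA andbb.
(* On the edges of [i], [y'] equals [xi], which the new allocation has absorbed; only the rest of
   [y'] remains to be added. *)
have wy'F F : sumE (sw s') (F :&: E) + sumE y' ((F :&: E) :\: Ei E0 i) <= phi F.
  apply: le_trans (y'F F); rewrite [X in _ <= X]big_split /= w'F -addrA lerD2l.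
  rewrite [X in _ <= X](big_setID (Ei E0 i)) /= lerD2r le_eqVlt; apply/orP; left.
  rewrite -setIA [E :&: _](setIidPr _) //; first apply/eqP/eq_bigr => e.
    by rewrite inE => /andP[_ /y'xi].
  by apply/subsetP=> e; rewrite inE => /andP[].
split=> // [k|k|b||S F Sact SF].
- by rewrite sc'; exact: inv_price.
- rewrite sp' sc' alloc' mulrDr; apply: lerD; first exact: inv_payment.
  by case: eqP => [->|_]; rewrite ?mulr0.
- rewrite sp'; case: eqP => [bi|_]; last by rewrite addr0 inv_budget.
  move: xid; rewrite inv_demand // -bi demand_lshift.
  case: eqP => [->|/eqP nc]; first by rewrite mul0r addr0 inv_budget.
  have c_gt0 : 0 < sc s (lshift m b) by rewrite bi lt_def -bi nc bi.
  case: (ltP _ (v b)) => _; rewrite lee_fin.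
    by rewrite ler_pdivlMr // mulrC lerBrDl.
  rewrite bi => xile; suff -> : sumE xi (Ei E0 i) = 0.
    by rewrite mulr0 addr0 -bi inv_budget.
  by apply/eqP; rewrite eq_le xile.
- apply/inP_ftot; split=> [e eE|F].
    by rewrite w'E addr_ge0 ?w0 //; case: ifP => // /xi0.
  apply: le_trans (wy'F F); rewrite lerDl; apply: sumr_ge0 => e.
  by rewrite in_setD in_setI => /and3P[_ _ /y'0].
have Sact0 := subset_trans Sact act'.
have [iS|iS] := boolP (i \in S).
  have := inv_xstar I Sact0 SF; rewrite w'F [F :&: Ei E0 i](setIidPr _); last first.
    apply: subset_trans SF; apply/subsetP=> e.
    by rewrite [e \in Ei _ _]inE [e \in ES _ _]inE => /andP[-> /eqP ->].
  suff -> : sumN (alloc s') S = sumN (alloc s) S + sumE xi (Ei E0 i) by lra.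
  rewrite /sumN (eq_bigr _ (fun k _ => alloc' k)) big_split /=; congr (_ + _).
  rewrite -big_mkcondr (big_pred1 i) // => k /=.
  by case: eqP => [->|_]; rewrite ?iS ?andbF.
(* Outside the edges of [i], [y'] supplies every buyer of [S] with at least its deficit, which the
   clinch of [i] leaves unchanged. *)
apply: le_trans (wy'F F); rewrite addrC lerD2l.
apply: le_trans (sumN_Ei_disjoint iS SF y'0).
rewrite /sumN -sumrB; apply: ler_sum => k kS.
have ki : k != i by apply: contraNneq iS => <-.
rewrite y'u // /u ki (subsetP Sact0) //= alloc' (negPf ki) addr0.
by rewrite le_max lexx orbT.
Qed.

Lemma inv_reachable s : reachable E0 f v B rho eps s -> auction_inv s.
Proof.
elim=> [|{}s s' _ I _ [sts [sts0 [step ->]]]]; first exact: inv_init.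
apply: inv_price_step.
(* Buyers clinch one after another, so the invariant passes through the intermediate states. *)
have : forall k, (k <= n + m)%N -> auction_inv (sts k).
  elim=> [_|k IH kN]; first by rewrite sts0.
  exact: inv_clinch_one (IH (ltnW kN)) (step (Ordinal kN)).
exact.
Qed.

(** * From the invariant to the bound on g *)

Lemma inv_gxd s (S : {set Nm}) : auction_inv s -> S \subset active s ->
  ((sumN xs S - sumN (alloc s) S)%:E <= gxd E0 f (alloc s) (sd s) S)%E.
Proof.
move=> I Sact; apply: le_bigmin => [|S' S'S]; first exact: leey.
have split_sum (z : Nm -> R) : sumN z S = sumN z S' + sumN z (S :\: S').
  by rewrite /sumN (big_setID S') /= (setIidPr S'S).
(* Deficits inside [S'] are bounded by the invariant with [F = ES E0 S''], those outside by the
   demands. *)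
have -> : sumN xs S - sumN (alloc s) S =
    (sumN xs S' - sumN (alloc s) S') + \sum_(k in S :\: S') (xs k - alloc s k).
  by rewrite sumrB !split_sum /sumN; lra.
rewrite EFinD; apply: leeD.
  apply: le_bigmin => [|S'' S'S'']; first exact: leey.
  rewrite lee_fin lerBrDr.
  have S'F : ES E0 S' \subset ES E0 S''.
    apply/subsetP=> e; rewrite !inE => /andP[-> /=]; exact: (subsetP S'S'').
  have := inv_xstar I (subset_trans S'S Sact) S'F.
  rewrite (setIidPl _) ?sumE_ES //.
  by apply/subsetP=> e; rewrite inE => /andP[].
rewrite -sumEFin; apply: lee_sum => k; rewrite inE => /andP[_ kS].
by apply: inv_deficit_le_demand => //; exact: (subsetP Sact).
Qed.

End Market.

Theorem theorem3p7 (n m : nat) (R : realFieldType)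
  (E0 : {set 'I_n * 'I_m}) (f : 'I_m -> {set 'I_n * 'I_m} -> R)
  (v B : 'I_n -> R) (rho : 'I_m -> R) (eps : R)
  (* each f_j : 2^{E_j} -> R_+ is monotone submodular with f_j(emptyset) = 0 *)
  (f_ge0 : forall j (F : {set 'I_n * 'I_m}), F \subset E0j E0 j -> 0 <= f j F)
  (f_set0 : forall j, f j set0 = 0)
  (f_mono : forall j (F G : {set 'I_n * 'I_m}), F \subset G -> G \subset E0j E0 j -> f j F <= f j G)
  (f_submod : forall j (F G : {set 'I_n * 'I_m}), F \subset E0j E0 j -> G \subset E0j E0 j ->
       f j (F :|: G) + f j (F :&: G) <= f j F + f j G)
  (v_gt0 : forall b, 0 < v b) (B_ge0 : forall b, 0 <= B b)
  (rho_gt0 : forall j, 0 < rho j)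
  (eps_gt0 : 0 < eps)
  (* truthful bids are positive integer multiples of eps *)
  (v_mult : forall b, exists k : nat, (0 < k)%N /\ v b = k%:R * eps)
  (rho_mult : forall j, exists k : nat, (0 < k)%N /\ rho j = k%:R * eps)
  (xs : 'I_(n + m) -> R) (Hxs : is_xstar E0 f v B rho xs)
  (s : state n m R)
  (Hreach : reachable E0 f v B rho eps s)
  (Hloop : exists i, sd s i != 0%E) :
  let x := fun i => sumE (sw s) (Ei E0 i) in
  let X := [set i | (0 < sd s i)%E] in
  forall S : {set 'I_(n + m)}, S \subset X ->
    ((sumN xs S - sumN x S)%:E <= gxd E0 f x (sd s) S)%E.
Proof.
move=> x X S SX.
have I : auction_inv E0 f v B rho xs s by apply: inv_reachable Hreach.
exact: inv_gxd I SX.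
Qed.
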